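(* On any instance $I=\langle (x_1,b_1),\dots,(x_n,b_n)\rangle$ on the real line, the social cost $SC_{\mathrm{medp}}(I)$ of the facility location chosen by the Median-Plus mechanism is at most the social cost $SC_{\mathrm{med}}(I)$ of the facility location chosen by the Median algorithm: $SC_{\mathrm{medp}}(I)\le SC_{\mathrm{med}}(I)$.
   Context: An instance with $n\ge1$ agents is $I=\langle (x_1,b_1),\dots,(x_n,b_n)\rangle$, with locations $x_i\in\mathbb{R}$ and preferred distances $b_i\in[0,B]$. The cost of agent $i$ for facility location $y\in\mathbb{R}$ is $cost(y,(x_i,b_i))=|x_i-b_i-y|$ if $y\le x_i$ and $|x_i+b_i-y|$ if $y>x_i$ (equivalently $\big||x_i-y|-b_i\big|$); the social cost of $y$ is $SC(y,I)=\sum_i cost(y,(x_i,b_i))$. The median of $n$ items is the item of rank $\lfloor (n+1)/2\rfloor$ in increasing order, ties among equal agent locations being resolved by a fixed ordering of the agents. The Median algorithm outputs $\mathrm{med}$, the median of $x_1,\dots,x_n$. Median-Plus mechanism: for each agent $i$, set $p_i=x_i+b_i$ if $x_i\le\mathrm{med}$ and $p_i=x_i-b_i$ otherwise (for agents with $x_i=\mathrm{med}$ the comparison is resolved by the fixed ordering: $p_i=x_i+b_i$ exactly for agents of rank at most $\lfloor (n+1)/2\rfloor$). Output the median of $p_1,\dots,p_n$. *)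

(* Defs.v *)
From HB Require Import structures.
From mathcomp Require Import all_boot all_order all_algebra.
From mathcomp Require Import reals.

Set Implicit Arguments.
Unset Strict Implicit.
Unset Printing Implicit Defensive.

Import Order.TTheory GRing.Theory Num.Theory.
Local Open Scope ring_scope.

(* An agent is a pair (x, b): location x, preferred distance b; an instance
   with n agents is a family 'I_n -> R * R of agents. *)

Definition cost (R : realType) (y : R) (a : R * R) : R :=
  if y <= a.1 then `|a.1 - a.2 - y| else `|a.1 + a.2 - y|.

Definition SC (R : realType) (n : nat) (y : R) (I : 'I_n -> R * R) : R :=
  \sum_(i < n) cost y (I i).

Definition median_rank (n : nat) : nat := (n.+1 %/ 2)%N.

(* Ranks start at 1, while nth counts from 0. The default value 0 of nth is
   returned only when n = 0. The value of the median does not depend on how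
   ties are broken. *)
Definition median (R : realType) (n : nat) (f : 'I_n -> R) : R :=
  nth 0 (sort <=%R (codom f)) (median_rank n).-1.

Definition med (R : realType) (n : nat) (I : 'I_n -> R * R) : R :=
  median (fun i => (I i).1).

(* The relation tb is the (non-strict) linear order on agents that breaks ties
   between equal locations; i itself is counted, so that ranks start at 1. *)
Definition agent_rank (R : realType) (n : nat) (tb : rel 'I_n)
    (I : 'I_n -> R * R) (i : 'I_n) : nat :=
  #|[set j | ((I j).1 < (I i).1) || (((I j).1 == (I i).1) && tb j i)]|.

Definition medp_point (R : realType) (n : nat) (tb : rel 'I_n)
    (I : 'I_n -> R * R) (i : 'I_n) : R :=
  let: (x, b) := I i in
  if (x < med I) ||
     ((x == med I) && (agent_rank tb I i <= median_rank n)%N)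
  then x + b else x - b.

Definition medp (R : realType) (n : nat) (tb : rel 'I_n)
    (I : 'I_n -> R * R) : R :=
  median (medp_point tb I).

(* Main.v *)
(* Put every agent at her peak p_i (x_i + b_i or x_i - b_i). The cost of agent i
   at y never exceeds |p_i - y|, with equality at y = med whichever way ties are
   broken; and the median of the p_i minimises the sum of the |p_i - y|. *)

Require Import Defs.
From HB Require Import structures.
From mathcomp Require Import all_boot all_order all_algebra.
From mathcomp Require Import reals.
From mathcomp Require Import zify lra.

Set Implicit Arguments.
Unset Strict Implicit.
Unset Printing Implicit Defensive.

Import Order.TTheory GRing.Theory Num.Theory.
Local Open Scope ring_scope.

(** Doubling the sum lets every index be paired with its mirror image, so the middle entry for odd
    [n] needs no separate case. *)
Lemma sum_median_le (R : realType) (n : nat) (f : 'I_n -> R) (y : R) :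
  \sum_(i < n) `|f i - median f| <= \sum_(i < n) `|f i - y|.
Proof.
set s := sort <=%R (codom f).
have sz : size s = n by rewrite size_sort size_codom card_ord.
have s_sorted : sorted <=%R s := sort_le_sorted _.
(* Pairing the j-th smallest value with the j-th largest. *)
have pairE z : (\sum_(i < n) `|f i - z|) *+ 2 =
    \sum_(i < n) (`|s`_i - z| + `|s`_(rev_ord i) - z|).
  have -> : \sum_(i < n) `|f i - z| = \sum_(i < n) `|s`_i - z|.
    transitivity (\sum_(x <- codom f) `|x - z|).
      by rewrite [RHS]big_map big_enum.
    rewrite (perm_big s) /=; last by rewrite perm_sym perm_sort.
    by rewrite (big_nth 0) big_mkord sz.
  by rewrite big_split /= mulr2n [X in _ + X](reindex_inj rev_ord_inj).
rewrite -(ler_pMn2r (n := 2)) ?pairE //; apply: ler_sum => i _.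
have s_homo j k : (j <= k < n)%N -> s`_j <= s`_k.
  case/andP=> jk kn; apply: (sorted_leq_nth le_trans lexx) => //;
  by rewrite inE sz // (leq_ltn_trans jk).
(* The median lies between the two members of each pair. *)
suff H j k : (j + k = n.-1)%N -> (j <= k)%N ->
    `|s`_j - median f| + `|s`_k - median f| <= `|s`_j - y| + `|s`_k - y|.
  have iE : (i + rev_ord i = n.-1)%N by rewrite /=; have := ltn_ord i; lia.
  case: (leqP i (rev_ord i)) => [|/ltnW] le_i; first exact: H.
  by rewrite addrC [leRHS]addrC; apply: H => //; rewrite addnC.
move=> jkE le_jk; have n_gt0 := leq_ltn_trans (leq0n i) (ltn_ord i).
(* Counted from 0, the median has index [(n - 1) %/ 2], which lies between [j] and [k] because
   [j + k = n - 1]. *)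
have lo : s`_j <= median f by apply: s_homo; rewrite /median_rank; lia.
have hi : median f <= s`_k by apply: s_homo; rewrite /median_rank; lia.
(* The left side collapses to [s]_k - s[_j], which the triangle inequality through [y] bounds. *)
rewrite ler0_norm ?subr_le0 // ger0_norm ?subr_ge0 //.
have := ler_norm (s`_k - y); have := ler_norm (y - s`_j).
rewrite (distrC y); lra.
Qed.

(** [cost] measures the distance to the peak on the same side of the agent as [y]; since the agent
    is the midpoint of the two peaks, that peak is the nearer one. *)
Lemma cost_le_peak (R : realType) (y : R) (a : R * R) :
  0 <= a.2 -> cost y a <= `|a.1 + a.2 - y| /\ cost y a <= `|a.1 - a.2 - y|.
Proof.
case: a => x b /= b_ge0; rewrite /cost /=.
by case: (leP y x) => xy; split=> //;
  rewrite ler_norml; apply/andP; split;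
  have := ler_norm (x + b - y); have := ler_norm (- (x - b - y));
  rewrite ?normrN; lra.
Qed.

Theorem lemma8 (R : realType) (B : R) (n : nat) (hn : (1 <= n)%N)
  (tb : rel 'I_n) (tb_total : total tb) (tb_trans : transitive tb)
  (tb_anti : antisymmetric tb)
  (I : 'I_n -> R * R) (hB : forall i : 'I_n, 0 <= (I i).2 <= B) :
  SC (medp tb I) I <= SC (med I) I.
Proof.
apply: (@le_trans _ _ (\sum_(i < n) `|medp_point tb I i - medp tb I|)).
  apply: ler_sum => i _; have /andP[b_ge0 _] := hB i.
  have [] := cost_le_peak (medp tb I) b_ge0.
  by rewrite /medp_point; case: (I i) => x b /=; case: ifP.
apply: le_trans (sum_median_le _ (med I)) _.
apply: ler_sum => i _; rewrite /medp_point /cost.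
case: (I i) (hB i) => x b /= _.
case: (ltgtP x (med I)) => //= ->.
(* At [x = med I], [cost] uses the left peak while the tie-breaking may select the right one; both
   are at distance [|b|] from [med I]. *)
by case: ifP => // _; rewrite 2!(addrC (med I)) !addrK normrN.
Qed.
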